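(* For every integer $k\ge 0$, \[ \alpha_4(2k+1)=\frac{(k+1)(k+2)(2k+3)}6 \qquad\text{and}\qquad \alpha_4(2k)=\binom{k+3}{3}+\binom{k+1}{3}. \]
   Context: For integers $q\ge 2$, $d\ge 0$, let $\Delta_q(d)=\{a\in\mathbb Z_{\ge0}^q:\sum_{i=1}^q a_i=d\}$, and let $e_1,\dots,e_q$ be the standard unit vectors of $\mathbb Z^q$. The graph $G_q(d)$ has vertex set $\Delta_q(d)$; distinct $a,b\in\Delta_q(d)$ are adjacent exactly when $a-b=e_i-e_j$ for some $i\ne j$. Write $\alpha_q(d)=\alpha(G_q(d))$ for its independence number. Binomial coefficients $\binom{n}{3}$ with $0\le n<3$ are $0$. *)

(* Defs.v *)
From mathcomp Require Import all_boot all_order all_algebra.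

Set Implicit Arguments.
Unset Strict Implicit.
Unset Printing Implicit Defensive.

Import GRing.Theory.
Local Open Scope ring_scope.

Definition independent (T : finType) (adj : rel T) (S : {set T}) : bool :=
  [forall a in S, forall b in S, ~~ adj a b].

Definition independence_number (T : finType) (adj : rel T) : nat :=
  \max_(S : {set T} | independent adj S) #|S|.

(* Nonnegative integer vectors with q entries and sum d. Each entry of such a
   vector is at most d, so taking entries in 'I_d.+1 loses nothing and makes
   the type finite. *)
Definition Delta (q d : nat) : finType :=
  {a : {ffun 'I_q -> 'I_d.+1} | (\sum_(i < q) a i)%N == d}.

Definition vec (q d : nat) (a : Delta q d) : 'rV[int]_q :=
  \row_(i < q) (val a i : nat)%:Z.

Definition unit_vec (q : nat) (i : 'I_q) : 'rV[int]_q := delta_mx 0 i.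

Definition adjG (q d : nat) : rel (Delta q d) := fun a b =>
  (a != b) && [exists i : 'I_q, exists j : 'I_q,
    (i != j) && (vec a - vec b == unit_vec i - unit_vec j)].

Definition alpha (q d : nat) : nat := independence_number (@adjG q d).

(* Main.v *)
Require Import Defs.
From mathcomp Require Import all_boot all_order all_algebra.
From mathcomp Require Import zify ring.

(** Call a vertex special if its parity vector lies in one fixed pair of
    complementary parity vectors (all even / all odd when [d] is even, odd
    exactly at [0] / even exactly at [0] when [d] is odd). Two special vertices
    agree modulo 2 everywhere or nowhere, whereas adjacent vertices disagree
    modulo 2 at exactly two of the four coordinates: the special vertices are
    independent. Conversely, attach to a special [s] and a coordinate [i] the
    clique [{s - e_i + e_j : j}] or [{s + e_i - e_j : j}], according to the
    parity vector of [s]. For odd [d] the cliques with [i = 0] partition the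
    graph. For even [d], giving the clique of [(s, i)] the weight [s_i] yields
    total weight [d] per special vertex, and each vertex is covered with weight
    at least [d]: if [v] has exactly two odd coordinates, its odd coordinates
    [i] contribute [v_i + 1] each and its even ones at least [v_i - 1] each. *)

Local Open Scope ring_scope.

Import GRing.Theory.

(** * Bounding independent sets by weighted clique covers *)

(** Double counting of pairs of a vertex of [S] and a clique through it: each clique meets [S] at
    most once, so its weight is counted at most once. *)
Lemma weighted_clique_bound {T W : finType} (adj : rel T) (K : W -> pred T)
    (w : W -> nat) (m : nat) (S : {set T}) :
  (forall c u v, K c u -> K c v -> u = v \/ adj u v) ->
  (forall v, m <= \sum_(c | K c v) w c)%N ->
  independent adj S -> (m * #|S| <= \sum_c w c)%N.
Proof.
move=> cliqueK coverK /forall_inP indS.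
have -> : (m * #|S| = \sum_(v in S) m)%N by rewrite sum_nat_const mulnC.
apply: (@leq_trans (\sum_(v in S) \sum_(c | K c v) w c)).
  by apply: leq_sum => v _; apply: coverK.
rewrite (exchange_big_dep xpredT) //=; apply: leq_sum => c _.
rewrite sum_nat_const -[leqRHS]mul1n leq_mul2r; apply/orP; right.
apply/card_le1_eqP => u v; rewrite !unfold_in => /andP[uS Ku] /andP[vS Kv].
have [//|auv] := cliqueK c v u Kv Ku.
by have /forall_inP/(_ _ uS) := indS v vS; rewrite auv.
Qed.

(** * Counting vertices and parity classes *)

Definition coord {q d : nat} (a : Delta q d) (i : 'I_q) : nat := val a i.

Lemma coord_inj {q d : nat} (a b : Delta q d) : coord a =1 coord b -> a = b.
Proof. by move=> eqab; apply/val_inj/ffunP => i; apply/val_inj/eqab. Qed.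

Lemma sum_coord {q d : nat} (a : Delta q d) : (\sum_i coord a i = d)%N.
Proof. exact/eqP/(valP a). Qed.

Lemma Delta_of {q d : nat} (f : 'I_q -> nat) :
  (\sum_i f i = d)%N -> {a : Delta q d | coord a =1 f}.
Proof.
move=> sumf.
have lef i : (f i < d.+1)%N by rewrite ltnS -sumf (bigD1 i) //= leq_addr.
pose g := [ffun i => inord (f i) : 'I_d.+1].
have gE i : g i = f i :> nat by rewrite ffunE inordK.
have gP : (\sum_i g i)%N == d by apply/eqP; rewrite -[RHS]sumf; apply: eq_bigr.
by exists (exist _ g gP).
Qed.

Lemma card_Delta (q d : nat) : #|Delta q.+1 d| = 'C(q + d, q).
Proof.
rewrite -card_ord_partitions card_sig cardsE.
(* [card_ord_partitions] counts tuples; [h] transfers the count to functions. *)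
pose h (a : {ffun 'I_q.+1 -> 'I_d.+1}) := [tuple a i | i < q.+1].
have hK : cancel h (fun t => [ffun i => tnth t i]).
  by move=> a; apply/ffunP => i; rewrite ffunE tnth_mktuple.
have Kh : cancel (fun t : q.+1.-tuple _ => [ffun i => tnth t i]) h.
  by move=> t; apply: eq_from_tnth => i; rewrite tnth_mktuple ffunE.
rewrite -(card_image (can_inj hK)); apply: eq_card => t.
apply/imageP/idP => [[a aP ->]|tP].
  apply/eqP; rewrite big_tuple -[RHS](eqP aP).
  by apply: eq_bigr => i _; rewrite tnth_mktuple.
exists [ffun i => tnth t i]; last by rewrite Kh.
apply/eqP; rewrite -[RHS](eqP tP) big_tuple.
by apply: eq_bigr => i _; rewrite ffunE.
Qed.

Definition parity_class {q : nat} (d : nat) (P : 'I_q -> bool) : {set Delta q d} :=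
  [set a | [forall i, odd (coord a i) == P i]].

Lemma parity_classP {q d : nat} (P : 'I_q -> bool) (a : Delta q d) :
  reflect (forall i, odd (coord a i) = P i) (a \in parity_class d P).
Proof. by rewrite inE; apply: (iffP forallP) => aP i; apply/eqP. Qed.

(** The map [b |-> 2b + P] is a bijection onto the class, with inverse coordinatewise halving. *)
Lemma card_parity_class {q : nat} (m d : nat) (P : 'I_q -> bool) :
  d = (m.*2 + \sum_i P i)%N -> #|parity_class d P| = #|Delta q m|.
Proof.
move=> dE.
have dblP (b : Delta q m) : (\sum_i ((coord b i).*2 + P i) = d)%N.
  by rewrite big_split /= dE -(big_morph double doubleD double0) sum_coord.
pose dbl b := sval (Delta_of _ (dblP b)).
have dblE b i : coord (dbl b) i = ((coord b i).*2 + P i)%N.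
  by rewrite /dbl; case: Delta_of => a /= ->.
have dbl_inj : injective dbl.
  move=> b c eqbc; apply: coord_inj => i.
  by have := dblE b i; rewrite eqbc dblE => /addIn/double_inj.
rewrite -(card_image dbl_inj); apply: eq_card => a.
apply/parity_classP/imageP => [aP|[b _ -> i]]; last first.
  by rewrite dblE oddD odd_double oddb.
have halfE i : coord a i = ((coord a i)./2.*2 + P i)%N.
  by rewrite -aP addnC odd_double_half.
have halfP : (\sum_i (coord a i)./2 = m)%N.
  apply: double_inj; apply/(@addIn (\sum_i P i)%N).
  rewrite -dE -[RHS](sum_coord a) (big_morph double doubleD double0).
  by rewrite -big_split /=; apply: eq_bigr => i _; rewrite -halfE.
have [b bE] := Delta_of _ halfP.
by exists b => //; apply: coord_inj => i; rewrite dblE bE -halfE.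
Qed.

Lemma parity_class_small {q : nat} (d : nat) (P : 'I_q -> bool) :
  (d < \sum_i P i)%N -> parity_class d P = set0.
Proof.
move=> ltdP; apply/setP => a; rewrite in_set0; apply/negP => /parity_classP aP.
move: ltdP; rewrite ltnNge -[X in (_ <= X)%N](sum_coord a) => /negP; apply.
apply: leq_sum => i _; rewrite -aP; case: (coord a i) => // n.
exact: leq_trans (leq_b1 _) _.
Qed.

(** * Adjacency as a unit shift *)

(** The relation [a = b - e_i + e_j], free of natural-number subtraction; [i = j] is allowed and
    means [a = b]. *)
Definition shifted {q d : nat} (a b : Delta q d) (i j : 'I_q) : bool :=
  [forall l, (coord a l + (l == i) == coord b l + (l == j))%N].

Lemma shiftedP {q d : nat} (a b : Delta q d) (i j : 'I_q) :
  reflect (forall l, coord a l + (l == i) = coord b l + (l == j))%N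
    (shifted a b i j).
Proof. by apply: (iffP forallP) => abP l; apply/eqP. Qed.

Lemma adjGP {q d : nat} (a b : Delta q d) :
  reflect (a != b /\ exists i j, i != j /\ shifted a b j i) (adjG a b).
Proof.
have vecE i j : (vec a - vec b == unit_vec i - unit_vec j) = shifted a b j i.
  apply/eqP/shiftedP => [/rowP eqab l|eqab].
    have := eqab l; rewrite !mxE /coord eqxx /=.
    by case: (l == i); case: (l == j) => /=; lia.
  apply/rowP => l; have := eqab l; rewrite !mxE /coord eqxx /=.
  by case: (l == i); case: (l == j) => /=; lia.
apply: (iffP andP) => -[neab].
  move=> /existsP[i /existsP[j /andP[neij]]].
  by rewrite vecE => sab; split => //; exists i, j.
move=> [i [j [neij sab]]]; split => //.
by apply/existsP; exists i; apply/existsP; exists j; rewrite neij vecE.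
Qed.

Lemma shifted_eq_or_adj {q d : nat} (u v : Delta q d) (i j : 'I_q) :
  shifted u v i j -> u = v \/ adjG u v.
Proof.
move=> /[dup] suv /shiftedP suvE; have [->|neuv] := eqVneq u v; first by left.
right; apply/adjGP; split=> //; exists j, i; split=> //.
apply: contra neuv => /eqP eqij; apply/eqP/coord_inj => l.
by have := suvE l; rewrite eqij => /addIn.
Qed.

Lemma shift_exists {q d : nat} (v : Delta q d) (i j : 'I_q) :
  (i == j) || (0 < coord v j)%N -> exists s : Delta q d, shifted s v j i.
Proof.
have [->|neij] /= := eqVneq i j; first by exists v; apply/shiftedP.
move=> vj.
(* The truncated subtraction is exact, since [coord v j] is positive. *)
have sumf : (\sum_l (coord v l + (l == i) - (l == j)) = d)%N.
  have sum1 t : (\sum_(l < q) (l == t) = 1)%N.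
    by rewrite (bigD1 t) //= eqxx big1 // => l /negPf ->.
  apply: (@addIn 1%N); rewrite -[in LHS](sum1 j) -[in RHS](sum1 i).
  rewrite -[X in _ = (X + _)%N](sum_coord v) -!big_split.
  apply: eq_bigr => l _ /=.
  by rewrite subnK //; case: (eqVneq l j) => // ->; lia.
have [s sE] := Delta_of _ sumf; exists s; apply/shiftedP => l.
by rewrite sE subnK //; case: (eqVneq l j) => // ->; lia.
Qed.

(** * Special vertices: independence and number *)

Definition special_parity (d : nat) (b : bool) (i : 'I_4) : bool :=
  b (+) (odd d && (i != 0)).

Definition special (d : nat) : {set Delta 4 d} :=
  parity_class d (special_parity d true) :|:
  parity_class d (special_parity d false).

Lemma specialP {d : nat} (a : Delta 4 d) :
  reflect (exists b, forall i, odd (coord a i) = special_parity d b i)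
    (a \in special d).
Proof.
rewrite inE; apply: (iffP orP) => [[]/parity_classP aP|[[]aP]].
- by exists true.
- by exists false.
- by left; apply/parity_classP.
- by right; apply/parity_classP.
Qed.

Lemma special_independent (d : nat) : independent (@adjG 4 d) (special d).
Proof.
apply/forall_inP => a /specialP[x aP]; apply/forall_inP => b /specialP[y bP].
apply/negP => /adjGP[_ [i [j [neij /shiftedP sab]]]].
(* Parities agree at a third coordinate [l] but differ at [i], which two special vertices cannot
   do. *)
have [l [neli nelj]] : exists l : 'I_4, l != i /\ l != j.
  have /card_gt0P[l] : (0 < #|[set~ i] :\ j|)%N.
    have := cardsD1 j [set~ i]; have := cardsC1 i; rewrite card_ord; lia.
  by rewrite !inE => /andP[nelj neli]; exists l.
have /(congr1 odd) := sab l; have /(congr1 odd) := sab i.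
rewrite !oddD !oddb !aP !bP /special_parity eqxx (negPf neij) (negPf neli).
rewrite (negPf nelj); case: x y {aP bP} => -[] //=;
  by case: (odd d); case: (i != 0); case: (l != 0).
Qed.

Lemma card_special (d : nat) :
  #|special d| = ('C(d./2 + 3, 3) + 'C(uphalf d + 1, 3))%N.
Proof.
have dE := odd_double_half d; have uE := uphalf_half d.
have sumP b : (\sum_i special_parity d b i =
    if odd d then (if b then 1 else 3) else (if b then 4 else 0))%N.
  by rewrite !big_ord_recl big_ord0 /special_parity; case: b; case: (odd d).
(* This class has the fewer odd coordinates: none for even [d], one for odd [d]. *)
have card_up : #|parity_class d (special_parity d (odd d))| = 'C(d./2 + 3, 3).
  rewrite (card_parity_class d./2) ?card_Delta; first by rewrite addnC.
  by rewrite sumP; case: (odd d) dE => /=; lia.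
have card_down :
    #|parity_class d (special_parity d (~~ odd d))| = 'C(uphalf d + 1, 3).
  (* Here 4 or 3 coordinates are odd. For [uphalf d < 2] the class is empty and the binomial is
     zero. *)
  have [ltd2|led2] := ltnP (uphalf d) 2.
    rewrite parity_class_small ?cards0 ?bin_small //; first by lia.
    by rewrite sumP; case: (odd d) dE uE => /=; lia.
  rewrite (card_parity_class (uphalf d - 2)) ?card_Delta.
    by congr 'C(_, _); lia.
  by rewrite sumP; case: (odd d) dE uE => /=; lia.
rewrite cardsU (_ : _ :&: _ = set0) ?cards0 ?subn0; last first.
  apply/setP => a; rewrite in_setI in_set0; apply/negP => /andP[].
  move=> /parity_classP/(_ 0) a0 /parity_classP/(_ 0).
  by rewrite a0 /special_parity; case: (odd d).
by rewrite -card_up -card_down; case: (odd d) => //; rewrite addnC.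
Qed.

(** * Cliques around special vertices and their covering weights *)

Definition special_clique {d : nat} (s : Delta 4 d) (i : 'I_4) :
    pred (Delta 4 d) := fun v =>
  (s \in special d) && [exists j,
    if odd (coord s 0) == odd d then shifted v s i j else shifted v s j i].

(** All members share the base [s - e_i] or [s + e_i], so two of them differ by a single difference
    of unit vectors. *)
Lemma special_clique_adj {d : nat} (s : Delta 4 d) (i : 'I_4)
    (u v : Delta 4 d) :
  special_clique s i u -> special_clique s i v -> u = v \/ adjG u v.
Proof.
move=> /andP[_ /existsP[j uP]] /andP[_ /existsP[j' vP]].
move: uP vP; case: ifP => _ /shiftedP uP /shiftedP vP.
  apply: (@shifted_eq_or_adj _ _ _ _ j' j); apply/shiftedP => l.
  have := uP l; have := vP l.
  by case: (l == i); case: (l == j); case: (l == j') => /=; lia.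
apply: (@shifted_eq_or_adj _ _ _ _ j j'); apply/shiftedP => l.
by rewrite uP -vP.
Qed.

(* Among the special vertices of the form v + e_i - e_j or v - e_i + e_j one
   looks for the right j: flipping the parities of v at i and j has to produce
   one of the two special parity vectors. *)
Lemma parity_partner (p : 'I_4 -> bool) (i : 'I_4) (c := odd (\sum_l p l)) :
  (c -> i = 0) -> exists (j : 'I_4) (b : bool),
  [/\ forall l, p l (+) (l == i) (+) (l == j) = b (+) (c && (l != 0)),
      i != j -> p j = b (+) ~~ c /\ p i = ~~ b
    & ~~ c -> (i != j) = (\sum_l p l == 2)%N].
Proof.
pose o n (ltn4 : (n < 4)%N) := Ordinal ltn4.
have pE : p =1 fun l => nth false
    [:: p (@o 0 isT); p (@o 1 isT); p (@o 2 isT); p (@o 3 isT)]%N l.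
  by case=> [[|[|[|[|//]]]] lt4] /=; congr p; apply/val_inj.
have sumE := eq_bigr _ (fun l (_ : true) => congr1 nat_of_bool (pE l)).
rewrite {}/c sumE {sumE}.
move: (p (@o _ _)) (p (@o _ _)) (p (@o _ _)) (p (@o _ _)) pE => b3 b2 b1 b0 pE.
rewrite !big_ord_recl big_ord0 /=; set n := (b0 + _)%N.
have choose (j : 'I_4) (b : bool) (q := nth false [:: b0; b1; b2; b3]) :
  (forall l : 'I_4, q l (+) (l == i) (+) (l == j) =
    b (+) (odd n && (l != 0))) ->
  (i != j -> q j = b (+) ~~ odd n /\ q i = ~~ b) ->
  (~~ odd n -> (i != j) = (n == 2)) ->
  exists (j : 'I_4) (b : bool),
  [/\ forall l, p l (+) (l == i) (+) (l == j) = b (+) (odd n && (l != 0)),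
      i != j -> p j = b (+) ~~ odd n /\ p i = ~~ b
    & ~~ odd n -> (i != j) = (n == 2)].
  by move=> H1 H2 H3; exists j, b; split=> // [l|]; rewrite !pE.
(* All 4 positions and 16 parity vectors are checked, searching the 8 pairs [(j, b)]; an odd sum
   with [i] nonzero contradicts [H]. *)
case: i choose => [[|[|[|[|//]]]] lti];
  case: b0 b1 b2 b3 {pE} @n => -[] [] [] n choose H;
  try (by have := congr1 val (H isT));
  solve [ let t := fun lt b => (apply: (choose (@o _ lt) b) => //;
            by case=> [[|[|[|[|//]]]] ltl]) in
     first [ t (isT : 0 < 4)%N true | t (isT : 0 < 4)%N false
           | t (isT : 1 < 4)%N true | t (isT : 1 < 4)%N false
           | t (isT : 2 < 4)%N true | t (isT : 2 < 4)%N false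
           | t (isT : 3 < 4)%N true | t (isT : 3 < 4)%N false ] ].
Qed.

(** For even [d], a mixed [v] admits [s_i = v_i + 1] at odd [v_i] and [s_i = v_i - 1] at positive
    even [v_i]; the boolean terms express this without subtraction. *)
Lemma special_clique_cover {d : nat} (v : Delta 4 d) (i : 'I_4)
    (mixed := (\sum_l odd (coord v l) == 2)%N) :
  (odd d -> i = 0) -> odd d || (0 < coord v i)%N ->
  exists2 s, special_clique s i v & ~~ odd d ->
    (coord v i + (mixed && odd (coord v i)) <=
     coord s i + (mixed && ~~ odd (coord v i)))%N.
Proof.
have oddE : odd (\sum_l odd (coord v l)) = odd d.
  rewrite -[in RHS](sum_coord v) !(big_morph odd oddD (erefl _)).
  by apply: eq_bigr => l _; rewrite oddb.
move=> i0 dvi.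
have [|j [b [parE ijE mixE]]] := parity_partner (odd \o coord v) i.
  by rewrite oddE.
rewrite oddE /= -/mixed in parE ijE mixE.
have specialE (s : Delta 4 d) :
    (forall l, odd (coord s l) = odd (coord v l) (+) (l == i) (+) (l == j)) ->
  s \in special d /\ odd (coord s 0) = b.
  move=> sE; split; first by apply/specialP; exists b => l; rewrite sE parE.
  by rewrite sE parE eqxx andbF addbF.
(* Here [s = v + e_i - e_j]: if [i != j], then [v_j] is odd, hence positive. *)
have [eb|nb] := eqVneq b (odd d).
  have [|s /[dup] sP /shiftedP sE] := shift_exists v i j.
    case: eqVneq => //= nij; have [jE _] := ijE nij.
    by apply: odd_gt0; rewrite jE eb addbN addbb.
  have [|sS s0] := specialE s.
    move=> l; have /(congr1 odd) := sE l; rewrite !oddD !oddb => <-.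
    by rewrite addbK.
  exists s; first rewrite /special_clique sS s0 eb eqxx /=.
    by apply/existsP; exists j; apply/shiftedP => l; rewrite -sE.
  move=> ed; have := mixE ed; have := sE i; rewrite eqxx.
  case: eqVneq ijE => [_ _|nij /(_ isT)[_ ->]] /= viE <- /=; first by lia.
  by rewrite eb (negPf ed) /=; lia.
(* Here [s = v - e_i + e_j]: positivity of [v_i] is assumed for even [d], and follows from its
   oddness for odd [d] and [i != j]. *)
have [|s /[dup] sP /shiftedP sE] := shift_exists v j i.
  rewrite eq_sym; case: eqVneq ijE => //= nij /(_ isT)[_ iE].
  case/orP: dvi => // od; apply: odd_gt0; rewrite iE.
  by move: nb; rewrite od; case: (b).
have [|sS s0] := specialE s.
  move=> l; have /(congr1 odd) := sE l; rewrite !oddD !oddb.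
  by rewrite addbAC => <-; rewrite addbK.
exists s; first rewrite /special_clique sS s0 (negPf nb) /=.
  by apply/existsP; exists j; apply/shiftedP => l; rewrite -sE.
move=> ed; have := mixE ed; have := sE i; rewrite eqxx.
case: eqVneq ijE => [_ _|nij /(_ isT)[_ ->]] /= viE <- /=; first by lia.
have -> : b by move: nb; rewrite (negPf ed); case: (b).
by rewrite /=; lia.
Qed.

Lemma special_max (d : nat) (S : {set Delta 4 d}) :
  independent (@adjG 4 d) S -> (#|S| <= #|special d|)%N.
Proof.
(* At [d = 0] the covering weight [m = d] would vanish; there the graph has a single vertex. *)
move=> indS; have [d0|d_gt0] := posnP d.
  rewrite card_special (leq_trans (max_card _)) // card_Delta.
  by rewrite d0.
pose wt (c : Delta 4 d * 'I_4) := ((c.1 \in special d) *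
  if odd d then (c.2 == 0%R : nat) else coord c.1 c.2)%N.
pose m := if odd d then 1%N else d.
have sum_wt : (\sum_c wt c = #|special d| * m)%N.
  rewrite -(pair_bigA _ (fun s i => wt (s, i))) /= -sum1_card big_distrl /=.
  rewrite [RHS]big_mkcond; apply: eq_bigr => s _; rewrite /wt /= -big_distrr /m /=.
  case: (s \in _) => //; rewrite !mul1n; case: (odd d); last exact: sum_coord.
  by rewrite (bigD1 0) //= big1 // => l /negPf ->.
have m_gt0 : (0 < m)%N by rewrite /m; case: (odd d).
rewrite -(leq_pmul2l m_gt0) [leqRHS]mulnC -sum_wt.
apply: (weighted_clique_bound (@adjG 4 d)
          (fun c => special_clique c.1 c.2)) indS.
  by move=> c u v; apply: special_clique_adj.
move=> v.
have wt_le s i : special_clique s i v ->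
    (wt (s, i) <= \sum_(s' | special_clique s' i v) wt (s', i))%N.
  by move=> sP; rewrite (bigD1 s) //= leq_addr.
have -> : (\sum_(c | special_clique c.1 c.2 v) wt c =
    \sum_i \sum_(s | special_clique s i v) wt (s, i))%N.
  rewrite (exchange_big_dep xpredT) //= pair_big_dep /=.
  by apply: eq_big => [[]|[]].
have [od|ed] := boolP (odd d).
  have [//||s sP _] := special_clique_cover v 0; first by rewrite od.
  rewrite (bigD1 0) //=; apply: leq_trans (leq_addr _ _).
  apply: leq_trans (wt_le _ _ sP); rewrite /wt /m od /=.
  by case/andP: sP => ->.
pose mixed := (\sum_l odd (coord v l) == 2)%N.
(* Summing the cover inequalities over [i]; where [v_i = 0] the left term is zero. *)
have : (\sum_i (coord v i + (mixed && odd (coord v i))) <=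
    \sum_i (\sum_(s | special_clique s i v) wt (s, i)
      + (mixed && ~~ odd (coord v i))))%N.
  apply: leq_sum => i _; have [->|vi_gt0] := posnP (coord v i); first by rewrite andbF.
  have [||s sP /(_ ed) sle] := special_clique_cover v i.
  - by rewrite (negPf ed).
  - by rewrite vi_gt0 orbT.
  apply: leq_trans sle _; rewrite leq_add2r; apply: leq_trans (wt_le _ _ sP).
  by rewrite /wt /= (negPf ed); case/andP: sP => -> _; rewrite mul1n.
rewrite !big_split /= sum_coord /m (negPf ed).
(* A mixed [v] has two odd and two even coordinates, so the corrections cancel. *)
have -> : (\sum_i (mixed && ~~ odd (coord v i)) =
           \sum_i (mixed && odd (coord v i)))%N.
  case mixedE: mixed => //=; apply: (@addIn (\sum_i odd (coord v i))%N).
  rewrite -big_split (eq_bigr (fun=> 1%N)) => [|l _]; last by case: odd.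
  by rewrite (eqP mixedE) sum1_card card_ord.
by rewrite leq_add2r.
Qed.

(** * Values of the independence number *)

Lemma alpha4E (d : nat) : alpha 4 d = ('C(d./2 + 3, 3) + 'C(uphalf d + 1, 3))%N.
Proof.
rewrite -card_special; apply/eqP; rewrite eqn_leq; apply/andP; split.
  by apply/bigmax_leqP => S; apply: special_max.
exact: (leq_bigmax_cond (special d) (special_independent d)).
Qed.

Theorem theorem5p2 (k : nat) :
  (alpha 4 (2 * k + 1))%:R =
    (k%:R + 1) * (k%:R + 2%:R) * (2%:R * k%:R + 3%:R) / 6%:R :> rat
  /\ alpha 4 (2 * k) = ('C(k + 3, 3) + 'C(k + 1, 3))%N.
Proof.
have [e1 e2 e3] : [/\ (2 * k + 1)./2 = k, (uphalf (2 * k + 1)).+1 = (k + 2)%N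
  & (2 * k)./2 = k] by split; lia.
have e4 : uphalf (2 * k) = k by lia.
rewrite !alpha4E e1 e3 e4 addn1 e2; split=> //.
(* Clears denominators: [(k+1)(k+2)(k+3) + k(k+1)(k+2) = (k+1)(k+2)(2k+3)]. *)
have six (n : nat) : ('C(n + 2, 3) * 6 = n * n.+1 * n.+2)%N.
  rewrite (_ : 6 = 3`!)%N // bin_ffact !addnS addn0 !ffactnS ffactn0 /=.
  by lia.
have six_neq0 : 6%:R != 0 :> rat by [].
apply: (mulIf six_neq0); rewrite divfK // -[LHS]natrM mulnDl six.
rewrite (_ : k + 3 = k.+1 + 2)%N ?six; last by lia.
by rewrite !(natrD, natrM, mulrS); ring.
Qed.
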